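(* Let $n\ge 1$ be an integer and let $k\ge 0$ be an even integer. Let $\mathcal{ST}_{k,n}$ be the arrangement in $\mathbb{R}^n$ of the hyperplanes $x_i+x_j=c$ for $c\in\{0,1,\dots,k\}$ and $1\le i<j\le n$. Then for every sufficiently large odd integer $t=2r+1$, \begin{align*} \chi_{\mathcal{ST}_{k,n}}(t) &= \sum_{1 \le q \le n} I(q)\, S(n,q)\, q! +\sum_{0 \le p \le \frac{k}{2}} n \Big( \sum_{1 \le q \le n-1} I_p(q)\, S(n-1,q)\, q!\Big)\\ &\quad+ \sum_{-r \le p \le -r +\frac{k}{2}-1} n \Big( \sum_{1 \le q \le n-1} I_p(q)\, S(n-1,q)\, q!\Big)\\ &\quad+ \sum_{0 \le p_1 \le \frac{k}{2},\ 0 \le p_2 \le \frac{k}{2}-1} n(n-1) \Big( \sum_{1 \le q \le n-2} I_{p_1,p_2}(q)\, S(n-2,q)\, q! \Big), \end{align*} where $r=\lfloor t/2\rfloor$ (so $-r=\lfloor -t/2\rfloor+1$ is written $\lfloor -\tfrac t2\rfloor$ in the paper's convention of representatives).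
   Context: The characteristic polynomial of an arrangement $\mathcal{A}$ in $\mathbb{R}^n$ is $\chi_{\mathcal{A}}(t)=\sum_{x\in L(\mathcal{A})}\mu(x)t^{\dim x}$, where $L(\mathcal{A})$ is the poset of nonempty intersections of hyperplanes of $\mathcal{A}$ (including $\mathbb{R}^n$) ordered by reverse inclusion and $\mu(x)=\mu(\mathbb{R}^n,x)$ is its Möbius function. $S(a,b)$ is the Stirling number of the second kind. For odd $t=2r+1$, identify $\mathbb{Z}/t\mathbb{Z}$ with the representatives $V=\{-r,\dots,-1,0,1,\dots,r\}$, with addition mod $t$. Let $G$ be the graph on $V$ in which distinct $a,b$ are adjacent iff $a+b\in\{0,1,\dots,k\}$ (mod $t$); for $a\in V$ let $N(a)=\{b\in V: a+b\in\{0,1,\dots,k\}\ (\mathrm{mod}\ t)\}$. Let $C_1=\{0,1,\dots,k/2\}$ and $C_2=\{-r,-r+1,\dots,-r+k/2-1\}$ ($t$ large enough that these are disjoint). A set of vertices is independent if no two of its elements are adjacent in $G$. Define: $I(q)$ = number of $q$-element independent subsets of $V\setminus(C_1\cup C_2)$; for $p\in C_1\cup C_2$, $I_p(q)$ = number of $q$-element independent subsets of $V\setminus(C_1\cup C_2\cup N(p))$; for $0\le p_1\le k/2$ and $0\le p_2\le k/2-1$, $I_{p_1,p_2}(q)$ = number of $q$-element independent subsets of $V\setminus(C_1\cup C_2\cup N(p_1)\cup N(-r+p_2))$. (All these quantities depend on $t$.)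
   Formalization: When the upper limit n-1 or n-2 of an inner sum is 0 (n=1 or n=2), the sum is taken as the single term q=0, equal to 1, instead of empty; as printed the formula fails, e.g. n=1 gives t-k-1 instead of t. *)

(* Defs.v *)
From HB Require Import structures.
From mathcomp Require Import all_boot all_order all_algebra finmap.
From mathcomp Require Import boolp classical_sets reals.

Set Implicit Arguments.
Unset Strict Implicit.
Unset Printing Implicit Defensive.

Import Order.TTheory GRing.Theory Num.Theory.
Local Open Scope ring_scope.

Section Moebius.
Variables (T : choiceType) (le : rel T) (P : {fset T}).

(* mu(x, x) = 1 and mu(x, y) = - sum_(x <= z < y) mu(x, z).  The argument m
   only bounds the depth of the recursion; m = #|P| always suffices, see
   moebiusE below. *)
Fixpoint moebius_rec (m : nat) (x y : T) : int :=
  if m isn't m'.+1 then 0 else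
  if x == y then 1 else
  - \sum_(z <- enum_fset P | [&& le x z, le z y & z != y]) moebius_rec m' x z.

Definition moebius (x y : T) : int := moebius_rec #|` P| x y.

Hypotheses (le_anti : antisymmetric le) (le_trans : transitive le).

Let below (y : T) : {fset T} := [fset z in P | le z y && (z != y)]%fset.

Let below_lt y z : z \in below y -> (#|` below z| < #|` below y|)%N.
Proof.
move=> zy; apply: fproper_ltn_card; rewrite fproperE.
apply/andP; split; last first.
  by apply/fsubsetPn; exists z => //; rewrite !inE eqxx !andbF.
apply/fsubsetP => u; move: zy.
rewrite !inE => /and3P[_ zy nzy] /and3P[-> uz nuz].
rewrite (le_trans uz zy) /=; apply: contra nzy => /eqP uy.
by apply/eqP/le_anti; rewrite zy -uy uz.
Qed.

Let below_card y : y \in P -> (#|` below y| < #|` P|)%N.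
Proof.
move=> yP; apply: fproper_ltn_card; rewrite fproperE; apply/andP; split.
  by apply/fsubsetP => u; rewrite !inE => /andP[].
by apply/fsubsetPn; exists y => //; rewrite !inE eqxx !andbF.
Qed.

Let moebius_rec_stable m1 m2 x y : (#|` below y| < m1)%N ->
  (#|` below y| < m2)%N -> moebius_rec m1 x y = moebius_rec m2 x y.
Proof.
elim: m1 m2 y => [//|m1 IH] [//|m2] y ym1 ym2 /=; case: ifP => // _.
congr (- _); rewrite big_seq_cond [RHS]big_seq_cond.
apply: eq_bigr => z /and4P[zP _ zy nzy].
have /below_lt zb : z \in below y by rewrite !inE zP zy nzy.
by apply: IH; apply: leq_trans zb _.
Qed.

Lemma moebiusE x y : y \in P ->
  moebius x y = if x == y then 1 else
    - \sum_(z <- enum_fset P | [&& le x z, le z y & z != y]) moebius x z.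
Proof.
move=> yP; rewrite {1}/moebius; have := below_card yP.
case: #|` P| (erefl #|` P|) => // m mP ym /=; case: ifP => // _.
congr (- _); rewrite big_seq_cond [RHS]big_seq_cond.
apply: eq_bigr => z /and4P[zP _ zy nzy].
apply: moebius_rec_stable; last exact: below_card.
have /below_lt zb : z \in below y by rewrite !inE zP zy nzy.
exact: leq_trans zb _.
Qed.

End Moebius.

Section Arrangement.
Variables (R : realType) (n : nat).
Implicit Types (A : {fset set 'rV[R]_n}) (x : set 'rV[R]_n).

Definition inter A : set 'rV[R]_n := (\bigcap_(H in [set` A]) H)%classic.

(* The empty subfamily contributes the ambient space. *)
Definition flats A : {fset set 'rV[R]_n} :=
  [fset x in [fset inter B | B in fpowerset A] | `[< (x !=set0)%classic >]]%fset.

Definition rev_incl : rel (set 'rV[R]_n) :=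
  fun x y => `[< (y `<=` x)%classic >].

Definition has_affine_dim x (d : nat) : Prop :=
  exists (v : 'rV[R]_n) (W : {vspace 'rV[R]_n}),
    x = [set u | u - v \in W]%classic /\ \dim W = d.

(* Every flat has a unique affine dimension; the default 0 is for sets that
   are not affine subspaces. *)
Definition affine_dim x : nat := xget 0%N [set d | has_affine_dim x d]%classic.

Lemma affine_dimP x d : has_affine_dim x d -> affine_dim x = d.
Proof.
move=> xd; apply: xget_unique => // e.
case: xd => v [W [-> <-]] [w [U [WU <-]]].
have vU : v - w \in U.
  suff : [set u | u - w \in U]%classic v by [].
  by rewrite -WU /= subrr mem0v.
congr (\dim _); apply/vspaceP => u.
have := congr1 (fun X : set 'rV[R]_n => X (u + v)) WU.
rewrite /= addrK -addrA rpredDr // => E.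
by apply/idP/idP; rewrite E.
Qed.

Definition char_poly_arr A : {poly int} :=
  \sum_(x <- enum_fset (flats A))
    moebius rev_incl (flats A) [set: 'rV[R]_n]%classic x *: 'X^(affine_dim x).

End Arrangement.

Definition ST_hyp (R : realType) (k n : nat) (i j : 'I_n) (c : 'I_k.+1) :
  set 'rV[R]_n := [set x : 'rV[R]_n | x 0 i + x 0 j = c%:R]%classic.

Definition ST (R : realType) (k n : nat) : {fset set 'rV[R]_n} :=
  [fset (ST_hyp ijc.1.1 ijc.1.2 ijc.2 : set 'rV[R]_n)
     | ijc : 'I_n * 'I_n * 'I_k.+1 & (ijc.1.1 < ijc.1.2)%N]%fset.

(* Number of partitions of an a-element set into b nonempty blocks. *)
Definition stirling2 (a b : nat) : nat :=
  #|[set P : {set {set 'I_a}} | finset.partition P [set: 'I_a] & #|P| == b]|.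

(* The vertex set V is 'Z_t, a representative a in {-r, ..., r} being the class
   a%:R (or - (- a)%:R); only t > 1 is meaningful, as 'Z_0 and 'Z_1 denote
   Z/2Z. *)
Section Graph.
Variables (k t : nat).
Let r : nat := t./2.
Implicit Types (a b p : 'Z_t) (W X : {set 'Z_t}) (q : nat).

Definition targets : {set 'Z_t} := [set (c : nat)%:R | c : 'I_k.+1].

Definition adj : rel 'Z_t := fun a b => (a != b) && (a + b \in targets).

Definition nbhd a : {set 'Z_t} := [set b | a + b \in targets].

Definition independent X : bool := [forall a in X, forall b in X, ~~ adj a b].

(* The class of -r + j. *)
Definition low (j : nat) : 'Z_t := - r%:R + j%:R.

Definition C1 : {set 'Z_t} := [set (c : nat)%:R | c : 'I_(k./2.+1)].
Definition C2 : {set 'Z_t} := [set low j | j : 'I_(k./2)].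

Definition num_indep W q : nat :=
  #|[set X : {set 'Z_t} | [&& X \subset W, #|X| == q & independent X]]|.

Definition I0 q : nat := num_indep (~: (C1 :|: C2)) q.

Definition I1 p q : nat := num_indep (~: (C1 :|: C2 :|: nbhd p)) q.

Definition I2 (p1 p2 : nat) q : nat :=
  num_indep (~: (C1 :|: C2 :|: nbhd p1%:R :|: nbhd (low p2))) q.

End Graph.

(* sum_(1 <= q <= m) I(q) S(m, q) q!, read as the single term I(0) S(0, 0) 0!
   when m = 0: the sum counts the maps from an m-element set whose image is an
   independent set, and for m = 0 there is exactly one, the empty map.  (With an
   empty sum for m = 0 the formula for the characteristic polynomial would fail
   in dimensions 1 and 2.) *)
Definition onto_sum (I : nat -> nat) (m : nat) : nat :=
  (\sum_(minn 1 m <= q < m.+1) I q * stirling2 m q * q`!)%N.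

(* Main.v *)
Require Import Defs.
From mathcomp Require Import all_boot all_order all_algebra reals.
From mathcomp Require Import ring zify.

(* For a set B of hyperplanes x_i + x_j = c, elimination uses only the
   invertibility of 2, so it is uniform in the ring: B is either inconsistent up
   to a nonzero integer, or its solutions are parametrized freely by the values
   at some set of coordinates.  Hence for t odd and large B has t ^ d solutions
   in (Z/t)^n, with d the dimension of the real flat (none if that flat is
   empty), and Whitney's theorem together with inclusion-exclusion identifies
   chi(t) with the number of points of (Z/t)^n avoiding every hyperplane.

   These points are the maps x from [n] to Z/t with x_i + x_j outside
   {0, ..., k} for i <> j.  The vertices a with 2 a in {0, ..., k} are exactly
   those of C1 and C2, which are cliques with no edge between them, so x takes
   at most one value in each of them, once; the other coordinates form a map
   with independent image, and S(m, q) q! counts the maps onto a q-set. *)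

Set Implicit Arguments.
Unset Strict Implicit.
Unset Printing Implicit Defensive.

Import Order.TTheory GRing.Theory Num.Theory.

(** * Maps with independent image *)

Section OntoMaps.

Lemma preim_partition_pblock (T V : finType) (f : T -> V) x y :
  (f x == f y) = (pblock (preim_partition f [set: T]) x ==
                  pblock (preim_partition f [set: T]) y).
Proof.
have /and3P[/eqP cov triv _] := preim_partitionP f [set: T].
rewrite eq_pblock ?cov ?inE //.
rewrite pblock_equivalence_partition ?inE // => {x y} x y z _ _ _ /=.
by split=> [|/eqP ->].
Qed.

(** A map with kernel [P] and image [X] is an injection of the blocks of [P] into [X]; as there are
    as many blocks as points of [X], there are [#|X|]! of these. [phi] composes such an injection
    with the block map, and a choice [r] of block representatives inverts it. *)
Lemma card_onto_kernel (T V : finType) (P : {set {set T}}) (X : {set V}) :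
  partition P [set: T] -> #|P| = #|X| ->
  #|[set f : {ffun T -> V} | (f @: [set: T] == X) &&
       (preim_partition f [set: T] == P)]| = #|X|`!.
Proof.
move=> /[dup] Pp /and3P[/eqP cov triv P0] PX.
have blkP i : pblock P i \in P by rewrite pblock_mem // cov inE.
pose Q : finType := {B | B \in P}.
pose blk i : Q := exist _ (pblock P i) (blkP i).
have blk_onto (B : Q) : exists i, blk i = B.
  have /set0Pn[i iB] : val B != set0.
    by apply: contraNneq P0 => <-; apply: valP.
  by exists i; apply: val_inj; apply: def_pblock iB => //; apply: valP.
have [r rK] := fin_all_exists blk_onto.
have cardQ : #|Q| = #|X| by rewrite -PX card_sig.
pose phi (g : {ffun Q -> V}) : {ffun T -> V} := [ffun i => g (blk i)].
have phi_inj : injective phi.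
  move=> g h /ffunP gh; apply/ffunP => B.
  by have := gh (r B); rewrite !ffunE rK.
transitivity #|phi @: [set g in ffun_on (mem X) | injectiveb g]|; last first.
  rewrite card_imset //; have := card_inj_ffuns_on Q (mem X).
  by rewrite cardQ ffactnn.
apply: eq_card => f; rewrite !inE; apply/andP/imsetP => [[/eqP fX /eqP fP]|].
  have fE x y : f x = f y <-> blk x = blk y.
    split=> [/eqP|/(congr1 val)/= /eqP].
      by rewrite preim_partition_pblock fP => /eqP xy; apply: val_inj.
    by rewrite -{1 2}fP -preim_partition_pblock => /eqP.
  exists [ffun B => f (r B)]; last by apply/ffunP => i; rewrite !ffunE; apply/fE; rewrite rK.
  rewrite !inE; apply/andP; split.
    by apply/ffun_onP => B; rewrite ffunE -fX; apply: imset_f; rewrite inE.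
  by apply/injectiveP => B C; rewrite !ffunE => /fE; rewrite !rK.
move=> [g]; rewrite inE => /andP[/ffun_onP gX /injectiveP g_inj] ->; split.
  rewrite eqEcard -cardQ; apply/andP; split.
    by apply/fintype.subsetP => _ /imsetP[i _ ->]; rewrite ffunE gX.
  rewrite -(card_codom g_inj); apply: subset_leq_card; apply/fintype.subsetP => _ /codomP[B ->].
  by apply/imsetP; exists (r B); rewrite ?inE // ffunE rK.
rewrite -[eqbRHS](equivalence_partition_pblock Pp); apply/eqP.
apply: eq_in_imset => x _; apply/setP => y; rewrite !inE /= !ffunE.
rewrite -eq_pblock ?cov ?inE //; apply/eqP/eqP => [/g_inj/(congr1 val)//|xy].
by congr (g _); apply: val_inj.
Qed.

(** Sort the surjections onto [X] by kernel: every partition into [#|X|] blocks is the kernel of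
    [#|X|]! of them. *)
Lemma card_onto (m : nat) (V : finType) (X : {set V}) :
  #|[set f : {ffun 'I_m -> V} | f @: [set: 'I_m] == X]| =
  (stirling2 m #|X| * #|X|`!)%N.
Proof.
rewrite /stirling2; set parts := [set P : {set {set 'I_m}} | _].
rewrite -sum1_card (partition_big (fun f : {ffun 'I_m -> V} =>
  preim_partition f [set: 'I_m]) (mem parts)) /=.
  rewrite -sum_nat_const; apply: eq_bigr => P; rewrite inE => /andP[Pp /eqP PX].
  rewrite sum1dep_card -(card_onto_kernel Pp PX).
  by apply: eq_card => f; rewrite !inE.
move=> f; rewrite !inE => /eqP <-; rewrite preim_partitionP /=.
(* The blocks of the kernel are the fibres over the points of the image, and distinct points have
   distinct fibres; hence there are [#|X|] blocks. *)
rewrite (_ : preim_partition _ _ =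
  (fun v => f @^-1: [set v]) @: (f @: [set: 'I_m])); last first.
  rewrite -imset_comp; apply: eq_in_imset => x _.
  by apply/setP => y; rewrite !inE eq_sym.
rewrite card_in_imset // => _ _ /imsetP[i _ ->] /imsetP[j _ ->] /setP/(_ i).
by rewrite !inE eqxx => /esym/eqP.
Qed.

End OntoMaps.

Section IndependentMaps.
Local Open Scope ring_scope.
Variables k t : nat.
Implicit Types (W : {set 'Z_t}).

Definition indep_maps (I : finType) W : {set {ffun I -> 'Z_t}} :=
  [set f : {ffun I -> 'Z_t} | [forall i, f i \in W] &&
     [forall i, forall j, f i + f j \notin targets k t]].

(** [adj] ignores the pair (a, a), whereas two coordinates of a map may share the value a. On such a
    set [W], [indep_maps] is therefore exactly independence of the image. *)
Definition loopless W := forall a, a \in W -> a + a \notin targets k t.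

Lemma card_indep_maps (m : nat) W : loopless W ->
  #|indep_maps 'I_m W| = onto_sum (num_indep k W) m.
Proof.
move=> Wl; pose im (f : {ffun 'I_m -> 'Z_t}) := f @: [set: 'I_m].
have imP f : (f \in indep_maps 'I_m W) = (im f \subset W) && independent k (im f).
  have fI l : f l \in im f by rewrite imset_f ?inE.
  rewrite inE; apply/andP/andP => [[/forallP fW /forallP fT]|[/fintype.subsetP fW /forall_inP fT]].
    split; first by apply/fintype.subsetP => _ /imsetP[i _ ->].
    apply/forall_inP => _ /imsetP[i _ ->]; apply/forall_inP => _ /imsetP[j _ ->].
    by rewrite negb_and (forallP (fT i) j) orbT.
  split; first by apply/forallP => i; apply: fW.
  apply/forallP => i; apply/forallP => j.
  have := forall_inP (fT _ (fI i)) _ (fI j); rewrite negb_and negbK.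
  by case/orP=> // /eqP ->; apply/Wl/fW.
transitivity (\sum_(minn 1 m <= q < m.+1)
    \sum_(f in indep_maps 'I_m W | #|im f| == q) 1)%N.
  rewrite (exchange_big_dep (mem (indep_maps 'I_m W))) /=; last by move=> q f _ /andP[].
  rewrite -sum1_card; apply: eq_bigr => f fI.
  rewrite (eq_bigl (fun q => q == #|im f|)) => [|q]; last by rewrite fI eq_sym.
  rewrite big_nat1_eq ifT // ltnS; apply/andP; split; last first.
    by rewrite -[X in (_ <= X)%N](card_ord m) -cardsT leq_imset_card.
  (* The image is empty only for m = 0, which accounts for the lower bound [minn 1 m]. *)
  case: m f fI {imP} @im => [|m] f fI im; first by rewrite minn0.
  rewrite (minn_idPl _) // card_gt0; apply/set0Pn; exists (f ord0).
  by rewrite imset_f ?inE.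
apply: eq_bigr => q _; rewrite /num_indep -mulnA -sum_nat_const.
rewrite (partition_big im (mem [set X : {set 'Z_t} |
   [&& X \subset W, #|X| == q & independent k X]])) /= => [|f]; last first.
  by rewrite imP inE => /andP[/andP[-> ->] ->].
apply: eq_bigr => X; rewrite inE => /and3P[XW /eqP <- XI].
rewrite -card_onto sum1dep_card; apply: eq_card => f.
rewrite [LHS]inE [RHS]inE imP -/(im f); case: (im f =P X) => [->|]; last by rewrite andbF.
by rewrite XW XI eqxx.
Qed.

(** The coordinates outside [A] are frozen at [x0], so restriction to [A], enumerated by ['I_#|A|],
    is a bijection onto the maps counted by [card_indep_maps]. *)
Lemma card_maps_off (n : nat) (A : {set 'I_n}) (x0 : 'I_n -> 'Z_t) W : loopless W ->
  #|[set x : {ffun 'I_n -> 'Z_t} | [&& [forall i in ~: A, x i == x0 i],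
       [forall i in A, x i \in W] &
       [forall i in A, forall j in A, x i + x j \notin targets k t]]]| =
  onto_sum (num_indep k W) #|A|.
Proof.
move=> Wl; rewrite -card_indep_maps //; set X := [set x | _].
pose restr (x : {ffun 'I_n -> 'Z_t}) := [ffun u : 'I_#|A| => x (enum_val u)].
have restr_inj : {in X &, injective restr}.
  move=> x y; rewrite !inE => /and3P[/forall_inP xA _ _] /and3P[/forall_inP yA _ _].
  move=> /ffunP xy; apply/ffunP => i; have [iA|iA] := boolP (i \in A).
    by have := xy (enum_rank_in iA i); rewrite !ffunE enum_rankK_in.
  by rewrite (eqP (xA i _)) ?(eqP (yA i _)) // inE.
rewrite -(card_in_imset restr_inj); apply: eq_card => f.
apply/imsetP/idP => [[x + ->]|].
  rewrite !inE => /and3P[_ /forall_inP xW /forall_inP xT].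
  apply/andP; split; apply/forallP => u; first by rewrite ffunE xW ?enum_valP.
  apply/forallP => v; rewrite !ffunE.
  exact: (forall_inP (xT _ (enum_valP u)) _ (enum_valP v)).
rewrite inE => /andP[/forallP fW /forallP fT].
pose x := [ffun i => if [pick u : 'I_#|A| | enum_val u == i] is Some u then f u else x0 i].
have xE u : x (enum_val u) = f u.
  rewrite ffunE; case: pickP => [v /eqP/enum_val_inj -> //|/(_ u)].
  by rewrite eqxx.
have AE i : i \in A -> exists u : 'I_#|A|, i = enum_val u.
  by move=> iA; exists (enum_rank_in iA i); rewrite enum_rankK_in.
exists x; last by apply/ffunP => u; rewrite ffunE xE.
rewrite inE; apply/and3P; split; apply/forall_inP => i.
- rewrite inE ffunE => iA; case: pickP => // u /eqP ui.
  by rewrite -ui enum_valP in iA.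
- by move=> /AE[u ->]; rewrite xE.
move=> /AE[u ->]; apply/forall_inP => j /AE[v ->]; rewrite !xE.
exact: (forallP (fT u) v).
Qed.

End IndependentMaps.

(** * Counting the points avoiding the hyperplanes *)

Section Counting.
Local Open Scope ring_scope.
Variables k n t : nat.
Hypotheses (k_even : ~~ odd k) (t_odd : odd t) (t_large : (4 * k + 10 <= t)%N).
Notation T := (targets k t).
Notation L1 := (C1 k t).
Notation L2 := (C2 k t).

Let t1 : (1 < t)%N. Proof. by lia. Qed.

Let ltZ (a : 'Z_t) : (a < t)%N.
Proof. by have := ltn_ord a; rewrite [X in (_ < X)%N -> _]Zp_cast. Qed.

Let valZ m : (m < t)%N -> (m%:R : 'Z_t) = m :> nat.
Proof. by move=> mt; rewrite val_Zp_nat // modn_small. Qed.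

Let natZ_inj : {in [pred m : nat | m < t]%N &, injective (fun m : nat => m%:R : 'Z_t)}.
Proof.
by move=> a b aT bT /(congr1 (@nat_of_ord _)); rewrite !valZ.
Qed.

(** As t = 2r + 1, the class of -r is that of r + 1. This allows working with the representatives 0,
    ..., t - 1, on which membership questions become linear arithmetic. *)
Lemma low_natr j : low t j = (t./2.+1 + j)%:R.
Proof.
apply/eqP; rewrite /low addrC subr_eq -natrD; apply/eqP/val_inj => /=.
rewrite !val_Zp_nat // (_ : _ + _ = t + j)%N ?modnDl //.
by have := odd_double_half t; rewrite t_odd; lia.
Qed.

Lemma mem_targets (a : 'Z_t) : (a \in T) = (a <= k)%N.
Proof.
apply/imsetP/idP => [[c _ ->]|ak].
  by rewrite valZ; have := ltn_ord c; lia.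
exists (Ordinal (ak : (a < k.+1)%N)) => //.
by apply/val_inj; rewrite /= valZ.
Qed.

Lemma mem_C1 (a : 'Z_t) : (a \in L1) = (a <= k./2)%N.
Proof.
apply/imsetP/idP => [[c _ ->]|ak].
  by rewrite valZ; have := ltn_ord c; lia.
exists (Ordinal (ak : (a < k./2.+1)%N)) => //.
by apply/val_inj; rewrite /= valZ.
Qed.

Lemma mem_C2 (a : 'Z_t) : (a \in L2) = (t./2 < a <= t./2 + k./2)%N.
Proof.
have th := odd_double_half t; rewrite t_odd in th.
apply/imsetP/idP => [[c _ ->]|/andP[a1 a2]].
  by rewrite low_natr valZ; have := ltn_ord c; lia.
have ak : (a - t./2.+1 < k./2)%N by lia.
exists (Ordinal ak) => //; rewrite low_natr.
by apply/val_inj; rewrite /= valZ subnKC.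
Qed.

(** A sum of two representatives below t wraps around at most once. *)
Lemma mem_addT (a b : 'Z_t) :
  (a + b \in T) = ((a + b <= k) || (t <= a + b <= t + k))%N.
Proof.
rewrite mem_targets /= [X in (_ %% X)%N]Zp_cast //.
have := ltZ a; have := ltZ b => bt at_; have [abt|abt] := ltnP (a + b) t.
  by rewrite modn_small //; lia.
by rewrite -{1}(subnK abt) modnDr modn_small; lia.
Qed.

(** As t is odd and k even, 2a is congruent to one of 0, ..., k only if a <= k/2 or r < a <= r +
    k/2, that is, only in C1 or C2. *)
Lemma loopless_setC (W : {set 'Z_t}) : loopless k (~: (L1 :|: L2 :|: W)).
Proof.
move=> a; rewrite !inE !negb_or mem_C1 mem_C2 mem_addT => /andP[/andP[a1 a2] _].
have th := odd_double_half t; rewrite t_odd in th.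
have kh := odd_double_half k; rewrite (negPf k_even) in kh.
have := ltZ a; lia.
Qed.

Lemma clique_C1 a b : a \in L1 -> b \in L1 -> a + b \in T.
Proof. by rewrite !mem_C1 mem_addT; lia. Qed.

Lemma clique_C2 a b : a \in L2 -> b \in L2 -> a + b \in T.
Proof.
have th := odd_double_half t; rewrite t_odd in th.
have kh := odd_double_half k; rewrite (negPf k_even) in kh.
by rewrite !mem_C2 mem_addT; lia.
Qed.

Lemma C1_C2_nonadjacent a b : a \in L1 -> b \in L2 -> a + b \notin T.
Proof.
have th := odd_double_half t; rewrite t_odd in th.
by rewrite mem_C1 mem_C2 mem_addT; lia.
Qed.

Lemma C1_C2_disjoint a : a \in L1 -> a \notin L2.
Proof.
have th := odd_double_half t; rewrite t_odd in th.
by rewrite mem_C1 mem_C2; lia.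
Qed.

Definition proper_maps : {set {ffun 'I_n -> 'Z_t}} :=
  [set x : {ffun 'I_n -> 'Z_t} |
     [forall i, forall j, (i != j) ==> (x i + x j \notin T)]].

Lemma proper_mapsP (x : {ffun 'I_n -> 'Z_t}) :
  reflect (forall i j, i != j -> x i + x j \notin T) (x \in proper_maps).
Proof.
rewrite inE; apply: (iffP forallP) => [xP i j|xP i].
  by move: (xP i) => /forallP/(_ j)/implyP.
by apply/forallP => j; apply/implyP; apply: xP.
Qed.

(** [S] holds the coordinates with a value in C1 or C2, frozen at [x0], and [N] is the union of the
    neighbourhoods of these values. Properness then asks the other coordinates to avoid [N] and to
    be pairwise compatible, which is the situation of [card_maps_off]. *)
Lemma card_proper_special (S : {set 'I_n}) (x0 : 'I_n -> 'Z_t) (N : {set 'Z_t}) :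
  {in S &, forall i j, i != j -> x0 i + x0 j \notin T} ->
  (forall b, b \in N <-> exists2 i, i \in S & x0 i + b \in T) ->
  #|[set x in proper_maps | [forall i, if i \in S then x i == x0 i
       else x i \notin L1 :|: L2]]| =
  onto_sum (num_indep k (~: (L1 :|: L2 :|: N))) #|~: S|.
Proof.
move=> x0P NP; rewrite -(card_maps_off _ x0 (@loopless_setC N)).
apply: eq_card => x; rewrite [LHS]inE [RHS]inE; apply/andP/and3P.
  move=> [/proper_mapsP xP /forallP xS]; split.
  - by apply/forall_inP => i; rewrite !inE negbK => iS; have := xS i; rewrite iS.
  - apply/forall_inP => i; rewrite inE => iS; have := xS i; rewrite (negPf iS) => xL.
    rewrite in_setC in_setU negb_or xL /=.
    apply/negP => /NP[j jS]; have := xS j; rewrite jS => /eqP <-.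
    by apply/negP/xP; apply: contraTneq jS => ->.
  apply/forall_inP => i; rewrite inE => iS; apply/forall_inP => j jS.
  (* Properness of [x] says nothing about the pair (i, i); there the condition holds because x_i
     lies outside C1 and C2. *)
  have [<-|ij] := eqVneq i j; last exact: xP.
  apply: (@loopless_setC set0); rewrite setU0 in_setC.
  by have := xS i; rewrite (negPf iS).
move=> [/forall_inP xS /forall_inP xW /forall_inP xT].
have xSN i j : i \in S -> j \notin S -> x i + x j \notin T.
  move=> iS jS; have := xW j; rewrite !inE jS => /(_ isT).
  rewrite negb_or => /andP[_]; apply: contraNN => xij; apply/NP; exists i => //.
  by rewrite -(eqP (xS i _)) // !inE negbK.
split.
  apply/proper_mapsP => i j ij.
  have [iS|iS] := boolP (i \in S); have [jS|jS] := boolP (j \in S).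
  - by rewrite (eqP (xS i _)) ?(eqP (xS j _)) ?inE ?negbK //; apply: x0P.
  - exact: xSN.
  - by rewrite addrC; apply: xSN.
  by apply: (forall_inP (xT i _)); rewrite inE.
apply/forallP => i; case: ifP => iS; first by apply: xS; rewrite !inE negbK.
have := xW i; rewrite !inE iS => /(_ isT).
by rewrite negb_or => /andP[].
Qed.

(** Two coordinates with values in [C] would sum to a target. So either no coordinate meets [C], or
    exactly one pair (p, i) contributes. Writing this as an identity with value 1 allows the
    identities of two cliques to be multiplied. *)
Lemma clique_count (C : {set 'Z_t}) (x : {ffun 'I_n -> 'Z_t}) :
  {in C &, forall a b, a + b \in T} -> x \in proper_maps ->
  ([forall i, x i \notin C] + \sum_(p in C) \sum_i (x i == p) = 1)%N.
Proof.
move=> Ccl /proper_mapsP xP; rewrite exchange_big /=.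
rewrite (eq_bigr (fun i => nat_of_bool (x i \in C))) => [|i _]; last first.
  have [xC|xC] := boolP (x i \in C).
    rewrite (bigD1 (x i)) //= eqxx big1 // => p /andP[_].
    by rewrite eq_sym => /negPf ->.
  by rewrite big1 // => p pC; case: eqP => // xp; rewrite xp pC in xC.
have [[i iC]|noC] := altP (@existsP _ (fun i => x i \in C)).
  rewrite (bigD1 i) //= iC big1 => [|j ji].
    suff /negPf -> : ~~ [forall i, x i \notin C] by [].
    by rewrite negb_forall; apply/existsP; exists i; rewrite negbK.
  case: (boolP (x j \in C)) => // jC.
  by have := xP j i ji; rewrite Ccl.
rewrite negb_exists in noC; rewrite noC big1 // => i _.
by rewrite (negPf (forallP noC i)).
Qed.

Lemma card_proper_avoiding :
  #|[set x in proper_maps | [forall i, x i \notin L1] && [forall i, x i \notin L2]]| =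
  onto_sum (I0 k t) n.
Proof.
have := @card_proper_special set0 (fun=> 0) set0; rewrite setU0 setC0 cardsT card_ord.
move=> <-; first last.
- by move=> b; rewrite inE; split=> // -[i]; rewrite inE.
- by move=> i j; rewrite inE.
apply: eq_card => x; rewrite !inE; congr (_ && _).
apply/andP/forallP => [[/forallP x1 /forallP x2] i|xL].
  by rewrite !inE negb_or x1 x2.
by split; apply/forallP => i; have := xL i; rewrite !inE negb_or => /andP[].
Qed.

(** Once x_i = p, properness keeps all other coordinates out of the clique [C], so only [C'] has to
    be excluded explicitly. *)
Lemma card_proper_one (C C' : {set 'Z_t}) (p : 'Z_t) (i : 'I_n) :
  {in C &, forall a b, a + b \in T} -> C :|: C' = L1 :|: L2 ->
  p \in C -> p \notin C' ->
  #|[set x in proper_maps | (x i == p) && [forall j, x j \notin C']]| =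
  onto_sum (I1 k p) n.-1.
Proof.
move=> Ccl CL pC pC'; have := @card_proper_special [set i] (fun=> p) (nbhd k p).
rewrite cardsC1 card_ord => <-; first last.
- move=> b; rewrite inE; split=> [pb|[]//]; by exists i; rewrite ?inE.
- by move=> j l; rewrite !inE => /eqP -> /eqP ->; rewrite eqxx.
apply: eq_card => x; rewrite [LHS]inE [RHS]inE; apply: andb_id2l => /proper_mapsP xP.
apply/andP/forallP => [[xi /forallP xC'] j|xS].
  rewrite inE; have [->//|ji] := eqVneq j i.
  rewrite -CL inE negb_or xC' andbT; apply: contraNN (xP j i ji) => xj.
  by rewrite (eqP xi) Ccl.
have xi : x i == p by have := xS i; rewrite inE eqxx.
split=> //; apply/forallP => j; have := xS j; rewrite inE.
have [->|ji] := eqVneq j i; first by rewrite (eqP xi).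
by rewrite -CL inE negb_or => /andP[].
Qed.

(** With both cliques occupied, properness alone keeps the other coordinates out of them; the two
    frozen values are compatible because no edge joins C1 to C2. *)
Lemma card_proper_two (p1 p2 : 'Z_t) (i j : 'I_n) : i != j ->
  p1 \in L1 -> p2 \in L2 ->
  #|[set x in proper_maps | (x i == p1) && (x j == p2)]| =
  onto_sum (num_indep k (~: (L1 :|: L2 :|: nbhd k p1 :|: nbhd k p2))) n.-2.
Proof.
move=> ij p1L p2L.
have := @card_proper_special [set i; j] (fun l => if l == i then p1 else p2)
  (nbhd k p1 :|: nbhd k p2).
rewrite [#|~: [set i; j]|]cardsCs setCK cards2 ij card_ord subn2 setUA => <-; first last.
- move=> b; rewrite !inE; split=> [/orP[] pb|[l]].
  + by exists i; rewrite ?inE ?eqxx.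
  + by exists j; rewrite ?inE ?eqxx ?orbT // eq_sym (negPf ij).
  by rewrite !inE => /orP[] /eqP ->; rewrite ?eqxx 1?eq_sym ?(negPf ij) => ->; rewrite ?orbT.
- move=> l m; rewrite !inE => /orP[] /eqP -> /orP[] /eqP ->; rewrite ?eqxx //.
  + by rewrite [j == i]eq_sym (negPf ij) => _; apply: C1_C2_nonadjacent.
  + by rewrite [j == i]eq_sym (negPf ij) => _; rewrite addrC; apply: C1_C2_nonadjacent.
apply: eq_card => x; rewrite [LHS]inE [RHS]inE; apply: andb_id2l => /proper_mapsP xP.
apply/andP/forallP => [[/eqP xi /eqP xj] l|xS].
  rewrite !inE; have [->|li] /= := eqVneq l i; first by rewrite xi.
  have [->|lj] /= := eqVneq l j; first by rewrite xj.
  rewrite negb_or; apply/andP; split.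
    by apply: contraNN (xP l i li) => xl; rewrite xi clique_C1.
  by apply: contraNN (xP l j lj) => xl; rewrite xj clique_C2.
have := xS i; have := xS j; rewrite !inE !eqxx orbT /=.
by rewrite [j == i]eq_sym (negPf ij).
Qed.

Lemma big_C1 (F : 'Z_t -> nat) :
  (\sum_(p in L1) F p = \sum_(0 <= p < k./2.+1) F p%:R)%N.
Proof.
rewrite big_mkord /C1 big_imset //= => a b _ _ /natZ_inj ab.
by apply/val_inj/ab; rewrite inE; [have := ltn_ord a | have := ltn_ord b]; lia.
Qed.

Lemma big_C2 (F : 'Z_t -> nat) :
  (\sum_(p in L2) F p = \sum_(0 <= j < k./2) F (low t j))%N.
Proof.
rewrite big_mkord /C2 big_imset //= => a b _ _; rewrite !low_natr => /natZ_inj ab.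
have th := odd_double_half t; rewrite t_odd in th.
apply/val_inj/(@addnI t./2.+1)/ab; rewrite inE;
  by [have := ltn_ord a; lia | have := ltn_ord b; lia].
Qed.

Lemma card_proper_maps : #|proper_maps| =
  (onto_sum (I0 k t) n
     + \sum_(0 <= p < k./2.+1) n * onto_sum (I1 k (p%:R : 'Z_t)%R) n.-1
     + \sum_(0 <= j < k./2) n * onto_sum (I1 k (low t j)) n.-1
     + \sum_(0 <= p1 < k./2.+1) \sum_(0 <= p2 < k./2)
         n * n.-1 * onto_sum (I2 k t p1 p2) n.-2)%N.
Proof.
have sum_bool (b : pred {ffun 'I_n -> 'Z_t}) :
    (\sum_(x in proper_maps) (b x : nat) = #|[set x in proper_maps | b x]|)%N.
  by rewrite -sum1dep_card [RHS]big_mkcondr; apply: eq_bigr => x _; case: (b x).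
pose a (C : {set 'Z_t}) (x : {ffun 'I_n -> 'Z_t}) := [forall i, x i \notin C].
pose s (C : {set 'Z_t}) (x : {ffun 'I_n -> 'Z_t}) := (\sum_(p in C) \sum_i (x i == p))%N.
(* Both factors are 1 by [clique_count]. Expanding the product splits the maps into those meeting
   neither clique, only C1, only C2, or both. *)
transitivity (\sum_(x in proper_maps) (a L1 x + s L1 x) * (a L2 x + s L2 x))%N.
  rewrite -sum1_card; apply: eq_bigr => x xP.
  by rewrite !clique_count //; [apply: clique_C2 | apply: clique_C1].
have one (C C' : {set 'Z_t}) : {in C &, forall a b, a + b \in T} ->
    C :|: C' = L1 :|: L2 -> {in C, forall p, p \notin C'} ->
    (\sum_(x in proper_maps) s C x * a C' x =
     \sum_(p in C) n * onto_sum (I1 k p) n.-1)%N.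
  move=> Ccl CL CC'; under eq_bigr => x _ do rewrite /s big_distrl /=.
  rewrite exchange_big /=; apply: eq_bigr => p pC.
  under eq_bigr => x _ do rewrite big_distrl /=.
  rewrite exchange_big /=.
  transitivity (\sum_(i < n) onto_sum (I1 k p) n.-1)%N; last by rewrite sum_nat_const card_ord.
  apply: eq_bigr => i _.
  rewrite -(card_proper_one i Ccl CL pC (CC' p pC)) -sum_bool.
  by apply: eq_bigr => x _; rewrite mulnb.
have two : (\sum_(x in proper_maps) s L1 x * s L2 x = \sum_(p1 in L1) \sum_(p2 in L2)
    n * n.-1 * onto_sum (num_indep k (~: (L1 :|: L2 :|: nbhd k p1 :|: nbhd k p2))) n.-2)%N.
  under eq_bigr => x _ do rewrite /s big_distrl /=.
  rewrite exchange_big /=; apply: eq_bigr => p1 p1L.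
  under eq_bigr => x _ do rewrite big_distrr /=.
  rewrite exchange_big /=; apply: eq_bigr => p2 p2L.
  under eq_bigr => x _ do rewrite big_distrl /=.
  rewrite exchange_big /= -mulnA; set c := onto_sum _ _.
  transitivity (\sum_(i < n) n.-1 * c)%N; last by rewrite sum_nat_const card_ord.
  apply: eq_bigr => i _.
  under eq_bigr => x _ do rewrite big_distrr /=.
  (* The term j = i vanishes, since one coordinate cannot take values in two disjoint cliques; n - 1
     choices of j remain. *)
  rewrite exchange_big /= (bigD1 i) //= big1 ?add0n => [|x _]; last first.
    rewrite mulnb; case: eqP => //= ->; case: eqP => // p12.
    by have := C1_C2_disjoint p1L; rewrite p12 p2L.
  have -> : n.-1 = #|[set~ i]| by rewrite cardsC1 card_ord.
  rewrite -sum_nat_const; apply: eq_big => [j|j]; first by rewrite !inE.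
  rewrite eq_sym => ij; rewrite /c -(card_proper_two ij p1L p2L) -sum_bool.
  by apply: eq_bigr => x _; rewrite mulnb.
under eq_bigr => x _ do rewrite mulnDl !mulnDr.
rewrite !big_split /= two big_C1 addnACA addnA; congr (_ + _ + _ + _)%N.
- by rewrite -card_proper_avoiding -sum_bool; apply: eq_bigr => x _; rewrite mulnb.
- by rewrite (one L1 L2) ?big_C1 //; [apply: clique_C1 | apply: C1_C2_disjoint].
- under eq_bigr => x _ do rewrite mulnC.
  rewrite (one L2 L1) ?big_C2 //; [exact: clique_C2 | by rewrite setUC|].
  by move=> p; apply: contraL; apply: C1_C2_disjoint.
by apply: eq_bigr => p1 _; rewrite big_C2.
Qed.

End Counting.

(** * Uniform elimination *)

Section SolvedSystems.
Local Open Scope ring_scope.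
Variable n : nat.

(* Encodes the equations x_i = sgn i * x_(rep i) + cst i / 2, the coordinates in
   params being free.  The constant is even whenever a parameter occurs, so that
   the equation 2 x = c obtained by identifying two occurrences of a parameter
   still yields a half-integer x = c / 2. *)
Record solved_system := SolvedSystem {
  params : {set 'I_n};
  sgn : 'I_n -> int;
  rep : 'I_n -> 'I_n;
  cst : 'I_n -> int;
  solved_params : forall i, i \in params -> [/\ sgn i = 1, rep i = i & cst i = 0];
  solved_bound : forall i, sgn i = 0 \/
    [/\ rep i \in params, sgn i = 1 \/ sgn i = -1 & exists b, cst i = b + b] }.

Definition solves (K : comUnitRingType) (s : solved_system) (x : 'I_n -> K) :=
  forall i, x i = (sgn s i)%:~R * x (rep s i) + (cst s i)%:~R / 2%:R.

Lemma solved_subst (s : solved_system) (v u : 'I_n) (tau b : int) :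
  v \in params s ->
  (tau = 0 \/ [/\ u \in params s, u != v, tau = 1 \/ tau = -1 & exists b', b = b' + b']) ->
  exists s', forall (K : comUnitRingType) (x : 'I_n -> K),
    solves s' x <-> solves s x /\ x v = tau%:~R * x u + b%:~R / 2%:R.
Proof.
move=> vS tauP.
pose sgn' i := if rep s i == v then sgn s i * tau else sgn s i.
pose rep' i := if rep s i == v then u else rep s i.
pose cst' i := if rep s i == v then cst s i + sgn s i * b else cst s i.
have free' i : i \in params s :\ v -> [/\ sgn' i = 1, rep' i = i & cst' i = 0].
  rewrite !inE => /andP[iv iS]; have [s1 r1 c1] := solved_params iS.
  by rewrite /sgn' /rep' /cst' r1 (negPf iv).
have bound' i : sgn' i = 0 \/
    [/\ rep' i \in params s :\ v, sgn' i = 1 \/ sgn' i = -1 & exists b, cst' i = b + b].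
  rewrite /sgn' /rep' /cst' !inE.
  have [s0|[rS s1 [d dE]]] := solved_bound s i.
    by left; case: ifP => _; rewrite s0 ?mul0r.
  case: ifPn => [/eqP rv|rv]; last by right; split; [rewrite rv | | exists d].
  case: tauP => [->|[uS uv t1 [b' b'E]]]; first by left; rewrite mulr0.
  right; split; first by rewrite uv uS.
    by case: s1 t1 => -> [] ->; [left|right|right|left].
  by exists (d + sgn s i * b'); rewrite dE b'E; ring.
exists (SolvedSystem free' bound') => K x.
have [sv rv cv] := solved_params vS.
have stepE i : x v = tau%:~R * x u + b%:~R / 2%:R ->
    (sgn s i)%:~R * x (rep s i) + (cst s i)%:~R / 2%:R =
    (sgn' i)%:~R * x (rep' i) + (cst' i)%:~R / 2%:R.
  move=> xv; rewrite /sgn' /rep' /cst'; case: ifPn => [/eqP ->|] //.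
  by rewrite xv !intrM intrD intrM; ring.
split=> [sx|[sx xv] i]; last by rewrite sx (stepE i xv).
have xv : x v = tau%:~R * x u + b%:~R / 2%:R.
  by have := sx v; rewrite /= /sgn' /rep' /cst' rv eqxx sv cv mul1r add0r mul1r.
by split=> // i; rewrite sx (stepE i xv).
Qed.

Definition edge_eq (K : comUnitRingType) (k : nat) (x : 'I_n -> K)
  (e : 'I_n * 'I_n * 'I_k.+1) := x e.1.1 + x e.1.2 = e.2%:R.

Lemma sign_transpose (K : comUnitRingType) (sg : int) (x y : K) :
  sg = 1 \/ sg = -1 -> sg%:~R * x = y <-> x = sg%:~R * y.
Proof.
move=> sgP; have sg2 : sg%:~R * sg%:~R = 1 :> K.
  by case: sgP => ->; rewrite ?mulrNN ?mulr1 // -intrM mulrNN mulr1.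
by split=> [<-|->]; rewrite mulrA sg2 mul1r.
Qed.

(** Inserting the solved forms turns the edge equation into one in at most two parameters. If none
    survives, it is vacuous or forces a nonzero integer to vanish. If one survives, it becomes a
    constant, after cancelling 2 when it occurs twice with equal signs. Of two distinct ones, the
    first is expressed by the second. *)
Lemma solved_add (k : nat) (s : solved_system) (e : 'I_n * 'I_n * 'I_k.+1) :
  (exists2 d : int, d != 0 & forall (K : comUnitRingType) (x : 'I_n -> K),
     (2%:R : K) \is a GRing.unit -> solves s x -> edge_eq x e -> d%:~R = 0 :> K) \/
  (exists s', forall (K : comUnitRingType) (x : 'I_n -> K),
     (2%:R : K) \is a GRing.unit -> solves s' x <-> solves s x /\ edge_eq x e).
Proof.
case: e => [[i j] c].
(* Twice the right-hand side after the constants [cst s i / 2] and [cst s j / 2] have been moved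
   over. *)
set d : int := c%:Z *+ 2 - cst s i - cst s j.
have edgeE (K : comUnitRingType) (x : 'I_n -> K) :
    (2%:R : K) \is a GRing.unit -> solves s x ->
    edge_eq x (i, j, c) <->
    (sgn s i)%:~R * x (rep s i) + (sgn s j)%:~R * x (rep s j) = d%:~R / 2%:R.
  move=> u2 sx; rewrite /edge_eq /= (sx i) (sx j).
  have -> : c%:R = (d + cst s i + cst s j)%:~R / 2%:R :> K.
    apply: (mulIr u2); rewrite divrK //.
    have -> : d + cst s i + cst s j = c%:Z *+ 2 by rewrite /d addrAC !subrK.
    by rewrite rmorphMn /= mulr_natr.
  rewrite (intrD K (_ + _)) (intrD K d) !mulrDl addrACA -[d%:~R / _ + _ + _]addrA.
  by split=> [/addIr|->].
have substE v u tau b : v \in params s ->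
    (tau = 0 \/ [/\ u \in params s, u != v, tau = 1 \/ tau = -1 & exists b', b = b' + b']) ->
    (forall (K : comUnitRingType) (x : 'I_n -> K), (2%:R : K) \is a GRing.unit ->
      (sgn s i)%:~R * x (rep s i) + (sgn s j)%:~R * x (rep s j) = d%:~R / 2%:R <->
      x v = tau%:~R * x u + b%:~R / 2%:R) ->
    exists s', forall (K : comUnitRingType) (x : 'I_n -> K),
     (2%:R : K) \is a GRing.unit -> solves s' x <-> solves s x /\ edge_eq x (i, j, c).
  move=> vS tauP eqP; have [s' s'E] := solved_subst vS tauP.
  exists s' => K x u2; rewrite s'E.
  by split=> -[sx xv]; split=> //; move: xv; rewrite edgeE // eqP.
have constE : (forall (K : comUnitRingType) (x : 'I_n -> K),
      (sgn s i)%:~R * x (rep s i) + (sgn s j)%:~R * x (rep s j) = 0) ->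
    (exists2 d : int, d != 0 & forall (K : comUnitRingType) (x : 'I_n -> K),
     (2%:R : K) \is a GRing.unit -> solves s x -> edge_eq x (i, j, c) ->
     d%:~R = 0 :> K) \/
    (exists s', forall (K : comUnitRingType) (x : 'I_n -> K),
     (2%:R : K) \is a GRing.unit ->
     solves s' x <-> solves s x /\ edge_eq x (i, j, c)).
  move=> lhs0; have [d0|d0] := eqVneq d 0.
    right; exists s => K x u2; split=> [sx|[]//]; split=> //.
    by rewrite edgeE // lhs0 d0 mul0r.
  left; exists d => // K x u2 sx; rewrite edgeE // lhs0 => /esym dh0.
  by rewrite -[LHS](divrK u2) dh0 mul0r.
case: (solved_bound s i) => [si0|[ri si [bi biE]]];
  case: (solved_bound s j) => [sj0|[rj sj [bj bjE]]].
- by apply: constE => K x; rewrite si0 sj0 !mul0r addr0.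
- right; apply: (substE (rep s j) (rep s j) 0 (sgn s j * d)) => //; first by left.
  move=> K x u2; rewrite si0 !mul0r !add0r sign_transpose //.
  by rewrite intrM mulrA.
- right; apply: (substE (rep s i) (rep s i) 0 (sgn s i * d)) => //; first by left.
  move=> K x u2; rewrite sj0 !mul0r addr0 add0r sign_transpose //.
  by rewrite intrM mulrA.
(* Both endpoints involve parameters, so both constants are even and so is [d]. This preserves the
   parity condition when one parameter replaces another. *)
have dE : d = (c%:Z - bi - bj) + (c%:Z - bi - bj) by rewrite /d biE bjE mulr2n; ring.
have [rE|rN] := eqVneq (rep s i) (rep s j); last first.
  right; apply: (substE (rep s i) (rep s j) (- (sgn s i * sgn s j)) (sgn s i * d)) => //.
    right; split=> //; first by rewrite eq_sym.
      by case: si sj => -> [] ->; rewrite ?mulr1 ?mulrN1 ?opprK; by [left|right].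
    by exists (sgn s i * (c%:Z - bi - bj)); rewrite dE mulrDr.
  move=> K x u2; rewrite -[X in _ <-> _ = X]addrC rmorphN /= mulNr.
  rewrite !intrM -!mulrA -mulrBr; apply: iff_trans _ (sign_transpose _ _ si).
  by split=> [<-|->]; rewrite ?addrK ?subrK.
have [sE|sN] := eqVneq (sgn s i) (sgn s j); last first.
  apply: constE => K x; rewrite rE -mulrDl -intrD.
  suff -> : sgn s i + sgn s j = 0 by rewrite mul0r.
  by case: si sj sN => -> [] ->.
(* With e = c - bi - bj the equation is 2 sgn x = e, whence x = sgn e / 2. Here e may be odd, which
   is allowed because x becomes constant. *)
right; apply: (substE (rep s j) (rep s j) 0 (sgn s j * (c%:Z - bi - bj))) => //.
  by left.
move=> K x u2; rewrite rE sE mul0r add0r intrM -mulrA.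
apply: iff_trans _ (sign_transpose _ _ sj); rewrite dE intrD mulrDl; split=> [E|->//].
by apply: (mulIr u2); rewrite !mulr_natr !mulr2n.
Qed.

(** Start with all coordinates free and add the edges one by one. The witness [d] or [s] is chosen
    before the ring [K], so the same one serves the reals and every Z/t with t odd. *)
Lemma solved_edges (k : nat) (E : seq ('I_n * 'I_n * 'I_k.+1)) :
  (exists2 d : int, d != 0 & forall (K : comUnitRingType) (x : 'I_n -> K),
     (2%:R : K) \is a GRing.unit -> (forall e, e \in E -> edge_eq x e) ->
     d%:~R = 0 :> K) \/
  (exists s, forall (K : comUnitRingType) (x : 'I_n -> K),
     (2%:R : K) \is a GRing.unit ->
     solves s x <-> forall e, e \in E -> edge_eq x e).
Proof.
elim: E => [|e E [[d d0 dE]|[s sE]]].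
- right.
  have f i : i \in [set: 'I_n] -> [/\ (1 : int) = 1, i = i & (0 : int) = 0] by [].
  have g (i : 'I_n) : (1 : int) = 0 \/ [/\ i \in [set: 'I_n],
      (1 : int) = 1 \/ (1 : int) = -1 & exists b : int, 0 = b + b].
    by right; split; [rewrite inE | left | exists 0].
  exists (SolvedSystem f g) => K x u2; split=> // _ i.
  by rewrite /= mul1r mulr0z mul0r addr0.
- left; exists d => // K x u2 xE; apply: dE u2 _ => e' e'E.
  by apply: xE; rewrite inE e'E orbT.
have consE (K : comUnitRingType) (x : 'I_n -> K) :
    (forall e', e' \in e :: E -> edge_eq x e') <->
    (forall e', e' \in E -> edge_eq x e') /\ edge_eq x e.
  split=> [xE|[xE xe] e']; last by rewrite inE => /predU1P[->//|/xE].
  by split=> [e' e'E|]; apply: xE; rewrite inE ?eqxx // e'E orbT.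
have [[d d0 dE]|[s' s'E]] := solved_add s e.
  left; exists d => // K x u2 /consE[xE xe].
  by apply: (dE K x u2 _ xe); apply/(sE _ _ u2).
by right; exists s' => K x u2; rewrite s'E // consE sE.
Qed.

End SolvedSystems.

From mathcomp Require Import finmap boolp classical_sets.

(** * Cardinality and dimension of the solution set of a solved system *)

Section SolutionSpaces.
Local Open Scope ring_scope.
Variable n : nat.
Implicit Type s : solved_system n.

Lemma solvesP (K : comUnitRingType) s (x : 'I_n -> K) :
  (forall i, sgn s i != 0 -> rep s i \in params s ->
     x i = (sgn s i)%:~R * x (rep s i) + (cst s i)%:~R / 2%:R) ->
  (forall i, sgn s i = 0 -> x i = (cst s i)%:~R / 2%:R) -> solves s x.
Proof.
move=> x1 x0 i; case: (solved_bound s i) => [s0|[rS s1 _]].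
  by rewrite x0 // s0 mul0r add0r.
by apply: x1 => //; case: s1 => ->.
Qed.

(** Restriction to the parameters, padded by 0 elsewhere, is a bijection from the solutions onto the
    arbitrary assignments of the parameters. *)
Lemma card_solves (K : finComUnitRingType) s :
  #|[set x : {ffun 'I_n -> K} | `[< solves s x >]]| = (#|K| ^ #|params s|)%N.
Proof.
pose restr (x : {ffun 'I_n -> K}) := [ffun i => if i \in params s then x i else 0].
rewrite -(card_pffun_on 0 (mem (params s)) (mem K)) -(card_in_imset (f := restr)).
  apply: eq_card => z; apply/imsetP/pffun_onP => [[x _ ->]|[zS _]].
    split=> //; apply/supportP => i iS; rewrite ffunE; case: ifPn => // iS'.
    by rewrite iS' in iS.
  exists [ffun i => (sgn s i)%:~R * z (rep s i) + (cst s i)%:~R / 2%:R].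
    rewrite !inE; apply: solvesP => [i _ rS|i s0]; rewrite !ffunE.
      by have [-> -> ->] := solved_params rS; rewrite mul1r mul0r addr0.
    by rewrite s0 mul0r add0r.
  apply/ffunP => i; rewrite !ffunE; case: ifPn => iS.
    by have [-> -> ->] := solved_params iS; rewrite mul1r mul0r addr0.
  by move/supportP: zS => ->.
move=> x y; rewrite !inE => xs ys /ffunP xy.
apply/ffunP => i. rewrite xs ys; have [->|[rS _ _]] := solved_bound s i.
  by rewrite !mul0r.
by have := xy (rep s i); rewrite !ffunE rS => ->.
Qed.

(** The solutions form the translate by the vector of [cst s i / 2] of the row space of [G], the
    matrix of coefficients of the parameters. On the parameter columns [G] is the identity, so its
    rows are independent. *)
Lemma solves_affine_dim (R : realType) s :
  has_affine_dim [set x : 'rV[R]_n | solves s (x 0)]%classic #|params s|.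
Proof.
pose G : 'M[R]_(#|params s|, n) :=
  \matrix_(u, i) ((sgn s i)%:~R * (enum_val u == rep s i)%:R).
have GE (z : 'rV[R]_#|params s|) u i : enum_val u = rep s i ->
    (z *m G) 0 i = (sgn s i)%:~R * z 0 u.
  move=> uE; rewrite mxE (bigD1 u) //= mxE uE eqxx mulr1 mulrC big1 ?addr0 //.
  move=> w wu; rewrite mxE -uE (inj_eq enum_val_inj) (negPf wu) !mulr0 //.
have G0 (z : 'rV[R]_#|params s|) i : sgn s i = 0 -> (z *m G) 0 i = 0.
  by move=> s0; rewrite mxE big1 // => u _; rewrite mxE s0 mul0r mulr0.
pose f : 'Hom('rV[R]_#|params s|, 'rV[R]_n) := linfun (mulmxr G).
have fE z : f z = z *m G by rewrite lfunE.
exists (\row_i ((cst s i)%:~R / 2%:R)), (limg f); split; last first.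
  rewrite limg_dim_eq; first by rewrite dimvf /dim /= mul1n.
  rewrite capfv; apply/eqP/lker0P => y z; rewrite !fE => yz.
  apply/rowP => u; move/rowP: yz => /(_ (enum_val u)).
  have [s1 r1 _] := solved_params (enum_valP u).
  by rewrite !(GE _ u) ?r1 // s1 !mul1r.
apply/seteqP; split=> x /=.
  move=> xs; apply/memv_imgP; exists (\row_u x 0 (enum_val u)); first exact: memvf.
  apply/rowP => i; rewrite fE [LHS]mxE [in X in _ + X]mxE mxE xs addrK.
  have [s0|[rS _ _]] := solved_bound s i; first by rewrite s0 G0 // mul0r.
  by rewrite (GE _ (enum_rank_in rS (rep s i))) ?mxE ?enum_rankK_in.
case/memv_imgP => z _; rewrite fE => xz.
have xE i : x 0 i = (z *m G) 0 i + (cst s i)%:~R / 2%:R.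
  by rewrite -xz !mxE subrK.
apply: solvesP => i; last by move=> s0; rewrite xE G0 // add0r.
move=> _ rS; have [s1 r1 c1] := solved_params rS.
have uE := enum_rankK_in rS rS.
by rewrite !xE (GE z _ i uE) (GE z _ (rep s i) (etrans uE (esym r1))) s1 c1 mul1r mul0r addr0.
Qed.

End SolutionSpaces.

(** * The characteristic polynomial as a point count *)

Section Whitney.
Local Open Scope ring_scope.

(** Expand the product of the factors 1 + f(a), where f is -1 on [A] and 0 elsewhere: subsets not
    contained in [A] contribute 0, and any a in [A] makes the product vanish. *)
Lemma sum_sign_subset (T : finType) (A : {set T}) :
  \sum_(B : {set T} | B \subset A) (-1) ^+ #|B| = (A == finset.set0)%:R :> int.
Proof.
pose f (a : T) : int := if a \in A then -1 else 0.
have <- : \prod_a (f a + 1) = (A == finset.set0)%:R.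
  have [A0|/finset.set0Pn[a aA]] := eqVneq A finset.set0.
    by rewrite big1 // => a _; rewrite /f A0 finset.in_set0 add0r.
  by rewrite (bigD1 a) //= /f aA addNr mul0r.
rewrite bigA_distr big_mkcond /=; apply: eq_bigr => B _.
case: ifPn => [/fintype.subsetP BA|/subsetPn[b bB bA]]; last first.
  by rewrite (bigD1 b) //= bB /f (negPf bA) mul0r.
rewrite -big_mkcond /= (eq_bigr (fun=> -1)) => [|b /BA bA].
  by rewrite prodr_const.
by rewrite /f bA.
Qed.

(** This merges a sum over flats of sums over the subfamilies cutting out each flat into one sum
    over subfamilies. *)
Lemma sum_fibers (T : choiceType) (I : finType) (P : {fset T}) (Q : pred T)
    (C : pred I) (h : I -> T) (s : I -> int) :
  \sum_(z <- enum_fset P | Q z) \sum_(i | C i && (h i == z)) s i =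
  \sum_(i | [&& C i, h i \in P & Q (h i)]) s i.
Proof.
rewrite (exchange_big_dep C) /=; last by move=> z i _ /andP[].
rewrite [RHS]big_mkcondr /=; apply: eq_bigr => i Ci.
rewrite (eq_bigl (predI Q (pred1 (h i)))) => [|z]; last by rewrite /= Ci eq_sym.
rewrite -big_filter filter_predI.
have [hP|hP] := boolP (h i \in P).
  by rewrite filter_pred1_uniq ?fset_uniq //=; case: (Q _); rewrite ?big_seq1 ?big_nil.
rewrite (@eq_in_filter _ (pred1 (h i)) pred0) ?filter_pred0 ?big_nil // => z zP /=.
by apply: contraNF hP => /eqP <-.
Qed.

Variables (R : realType) (n : nat) (E : finType) (D : {set E}).
Variables (H : E -> set 'rV[R]_n) (A : {fset set 'rV[R]_n}).
Hypothesis AP : forall h, h \in A <-> exists2 e, e \in D & h = H e.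
Hypothesis H_proper : forall e, e \in D -> H e <> [set: 'rV[R]_n]%classic.

Definition common (B : {set E}) : set 'rV[R]_n :=
  [set x | forall e, e \in B -> H e x]%classic.

Lemma flatsP F : F \in flats A <->
  (exists2 B : {set E}, B \subset D & F = common B) /\ (F !=set0)%classic.
Proof.
have interE (A' : {fset set 'rV[R]_n}) (B : {set E}) :
    (forall h, h \in A' <-> exists2 e, e \in B & h = H e) -> inter A' = common B.
  move=> A'P; apply/seteqP; split=> x /= xI.
    by move=> e eB; apply: xI => /=; apply/A'P; exists e.
  by move=> h /= /A'P[e eB ->]; apply: xI.
rewrite /flats; split.
  rewrite !inE /= => /andP[/imfsetP[A' /=]]; rewrite fpowersetE => /fsubsetP A'A -> /asboolP ne.
  split=> //; exists [set e in D | H e \in A'].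
    by apply/fintype.subsetP => e; rewrite inE => /andP[].
  apply: interE => h; split=> [hA'|[e]]; last by rewrite inE => /andP[_ ? ->].
  by have /AP[e eD hE] := A'A _ hA'; exists e => //; rewrite inE eD -hE.
move=> [[B BD ->] ne]; rewrite !inE /=; apply/andP; split; last exact/asboolP.
apply/imfsetP; exists [fset H e | e in B]%fset => /=.
  rewrite fpowersetE; apply/fsubsetP => h /imfsetP[e /= eB ->]; apply/AP.
  by exists e => //; apply: (fintype.subsetP BD).
by apply/esym/interE => h; split=> [/imfsetP[e /= eB ->]|[e eB ->]];
  [exists e | apply: in_imfset].
Qed.

(** The localization of the arrangement at [F], as a set of labels. *)
Definition above (F : set 'rV[R]_n) : {set E} :=
  [set e in D | `[< (F `<=` H e)%classic >]].

Lemma sub_above (B : {set E}) (F : set 'rV[R]_n) :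
  (B \subset above F) = (B \subset D) && rev_incl (common B) F.
Proof.
apply/idP/andP => [/fintype.subsetP BF|[BD /asboolP FB]].
  split; first by apply/fintype.subsetP => e /BF; rewrite inE => /andP[].
  apply/asboolP => x Fx e /BF; rewrite inE => /andP[_ /asboolP]; exact.
apply/fintype.subsetP => e eB; rewrite inE (fintype.subsetP BD) //=.
by apply/asboolP => x /FB; apply.
Qed.

(* Both sides satisfy the same recursion: the signs of the subfamilies of
   [above F] add up to 0 unless F is the whole space. *)
Lemma moebius_flats F : F \in flats A ->
  moebius (@rev_incl R n) (flats A) [set: 'rV[R]_n]%classic F =
  \sum_(B : {set E} | (B \subset D) && (common B == F)) (-1) ^+ #|B|.
Proof.
have anti : antisymmetric (@rev_incl R n).
  by move=> x y /andP[/asboolP yx /asboolP xy]; apply/seteqP.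
have trans : transitive (@rev_incl R n).
  move=> y x z /asboolP yx /asboolP zy; apply/asboolP.
  exact: subset_trans zy yx.
(* The recursion visits the flats strictly containing [F]. These lie in strictly fewer hyperplanes,
   as a flat is the intersection of the hyperplanes through it. *)
have [m] := ubnP #|above F|; elim: m F => // m IH F Fm FA.
rewrite moebiusE //; have [[B0 B0D FB0] Fne] := (flatsP F).1 FA.
case: ifPn => [/eqP FT|FT].
  rewrite (big_pred1 finset.set0) ?cards0 // => B /=.
  apply/andP/eqP => [[BD /eqP BF]|->]; last first.
    rewrite finset.sub0set; split=> //; rewrite -FT; apply/eqP/seteqP; split=> // x _ e.
    by rewrite finset.in_set0.
  apply/eqP; apply: contraT => /finset.set0Pn[e eB].
  case: (H_proper (fintype.subsetP BD e eB)); apply/seteqP; split=> // x _.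
  have : common B x by rewrite BF -FT.
  exact.
have aboveF : above F != finset.set0.
  apply/finset.set0Pn; have : B0 != finset.set0.
    apply: contra_neq FT => B00; rewrite FB0 B00; apply/seteqP; split=> // x _ e.
    by rewrite finset.in_set0.
  move=> /finset.set0Pn[e eB]; exists e; apply: fintype.subsetP eB.
  by rewrite sub_above B0D FB0; apply/asboolP.
rewrite big_seq_cond (eq_bigr (fun z =>
  \sum_(B : {set E} | (B \subset D) && (common B == z)) (-1) ^+ #|B|)); last first.
  move=> z /and4P[zA _ /[dup] zF /asboolP Fz nzF]; apply: IH => //.
  apply: leq_trans (_ : (#|above z| < #|above F|)%N) _; last by rewrite -ltnS.
  apply: proper_card; rewrite properE; apply/andP; split.
    apply/fintype.subsetP => e; rewrite !inE => /andP[-> /asboolP ze].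
    by apply/asboolP; apply: subset_trans Fz ze.
  apply: contra nzF; rewrite sub_above => /andP[_ /asboolP FzF].
  apply/eqP/seteqP; split=> //; apply: subset_trans FzF _.
  move=> x xB; rewrite FB0 => e eB; apply: xB; rewrite inE (fintype.subsetP B0D) //=.
  by apply/asboolP; rewrite FB0 => y; apply.
rewrite -big_seq_cond sum_fibers.
have := sum_sign_subset (above F); rewrite (negPf aboveF).
rewrite (bigID (fun B => common B == F)) /= => /eqP; rewrite addr_eq0 => /eqP sE.
rewrite (eq_bigl (fun B : {set E} => (B \subset above F) && (common B != F))).
  rewrite -sE; apply: eq_bigl => B; rewrite sub_above -andbA; congr (_ && _).
  by apply/andP/idP => [[]//|/eqP ->]; split=> //; apply/asboolP.
move=> B; rewrite sub_above -andbA; case: (boolP (B \subset D)) => //= BD.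
have -> : rev_incl [set: 'rV[R]_n]%classic (common B) by apply/asboolP.
case: (boolP (rev_incl _ F)) => [/asboolP FB|]; rewrite ?andbF //=.
case: (common B == F); rewrite ?andbF // ?andbT.
apply/flatsP; split; first by exists B.
by have [x Fx] := Fne; exists x; apply: FB.
Qed.

(** Insert [moebius_flats] and regroup: each subfamily with a common point is counted once, at the
    flat it cuts out. *)
Lemma whitney (t : int) :
  (char_poly_arr A).[t] =
  \sum_(B : {set E} | (B \subset D) && `[< (common B !=set0)%classic >])
     (-1) ^+ #|B| * t ^+ affine_dim (common B).
Proof.
rewrite /char_poly_arr horner_sum big_seq_cond.
rewrite (eq_bigr (fun z => \sum_(B : {set E} | (B \subset D) && (common B == z))
   (-1) ^+ #|B| * t ^+ affine_dim (common B))); last first.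
  move=> F; rewrite andbT => FA; rewrite moebius_flats // hornerZ hornerXn mulr_suml.
  by apply: eq_bigr => B /andP[_ /eqP ->].
rewrite -big_seq_cond sum_fibers; apply: eq_bigl => B.
case: (boolP (B \subset D)) => //= BD; rewrite andbT.
apply/idP/asboolP => [/flatsP[]//|ne]; apply/flatsP; split=> //.
by exists B.
Qed.

End Whitney.

(** * Point counts over Z/t for large odd t *)

Section FiniteFieldMethod.
Local Open Scope ring_scope.
Variables (k n : nat).
Notation edge := ('I_n * 'I_n * 'I_k.+1)%type.

Definition ordered_edges : {set edge} := [set e : edge | (e.1.1 < e.1.2)%N].

Lemma Zp_int_eq0 (t : nat) (d : int) : (1 < t)%N ->
  d%:~R = 0 :> 'Z_t -> (t %| `|d|)%N.
Proof.
move=> t1 d0; suff /(congr1 (@nat_of_ord _)) : `|d|%N%:R = 0 :> 'Z_t.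
  by rewrite val_Zp_nat // => /eqP.
by case: d d0 => // m; rewrite NegzE rmorphN /= => /eqP; rewrite oppr_eq0 => /eqP.
Qed.

Lemma card_edge_solutions (R : realType) (B : {set edge}) :
  exists t0 : nat, forall t : nat, (t0 <= t)%N -> odd t ->
    #|[set x : {ffun 'I_n -> 'Z_t} | [forall e in B, x e.1.1 + x e.1.2 == e.2%:R]]|
    = if `[< (common (fun e : edge => @ST_hyp R k n e.1.1 e.1.2 e.2) B !=set0)%classic >]
      then (t ^ affine_dim (common (fun e : edge => @ST_hyp R k n e.1.1 e.1.2 e.2) B))%N
      else 0%N.
Proof.
set F := common _ B.
have FE x : F x <-> forall e, e \in enum B -> edge_eq (x 0) e.
  by split=> xF e eB; apply: xF; rewrite mem_enum in eB *.
have u2R : (2%:R : R) \is a GRing.unit by rewrite unitfE pnatr_eq0.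
have u2Z t : (1 < t)%N -> odd t -> (2%:R : 'Z_t) \is a GRing.unit.
  by move=> t1 ot; rewrite unitZpE // coprimen2.
have [[d d0 dE]|[s sE]] := solved_edges (enum B).
  (* A solution over Z/t would make t divide the nonzero [d], impossible for t > |d|; a real
     solution would give d = 0. The bound also ensures t > 1, so that ['Z_t] is Z/t. *)
  exists (`|d|.+2)%N => t td ot; rewrite ifF; last first.
    apply/asboolP => -[x /FE xF]; move: d0; rewrite -(intr_eq0 R).
    by rewrite (dE R (x 0)) ?eqxx.
  apply/eqP; rewrite cards_eq0; apply/eqP/setP => x; rewrite !inE.
  apply/negP => /forall_inP xB; have t1 : (1 < t)%N by apply: leq_trans td.
  have : d%:~R = 0 :> 'Z_t.
    apply: (dE _ x (u2Z t t1 ot)) => e; rewrite mem_enum => /xB /eqP; exact.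
  move/(Zp_int_eq0 t1)/dvdn_leq; rewrite absz_gt0 => /(_ d0) td'.
  by move: (leq_trans td td'); rewrite ltnNge leqW.
exists 2 => t t1 ot.
have FsE : F = [set x : 'rV[R]_n | solves s (x 0)]%classic.
  by apply/seteqP; split=> x; [move=> /FE xF; apply/(sE _ _ u2R)|move/(sE _ _ u2R)/FE].
have Fdim : has_affine_dim F #|params s| by rewrite FsE; apply: solves_affine_dim.
rewrite ifT; last first.
  by apply/asboolP; have [v [W [-> _]]] := Fdim; exists v; rewrite /= subrr mem0v.
rewrite (affine_dimP Fdim).
transitivity (#|{: 'Z_t}| ^ #|params s|)%N; last by rewrite card_ord Zp_cast.
rewrite -card_solves; apply: eq_card => x; rewrite !inE.
apply/forall_inP/idP => [xB|].
  by apply/asboolP/(sE _ _ (u2Z t t1 ot)) => e; rewrite mem_enum => /xB /eqP.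
by move=> /asboolP/(sE _ _ (u2Z t t1 ot)) xB e eB; apply/eqP/xB; rewrite mem_enum.
Qed.

Definition avoiding (t : nat) : {set {ffun 'I_n -> 'Z_t}} :=
  [set x : {ffun 'I_n -> 'Z_t} |
     [forall e in ordered_edges, x e.1.1 + x e.1.2 != e.2%:R]].

Lemma char_poly_ST (R : realType) :
  exists t0 : nat, forall t : nat, (t0 <= t)%N -> odd t ->
    (char_poly_arr (ST R k n)).[t%:Z] = #|avoiding t|%:Z.
Proof.
pose H (e : edge) := @ST_hyp R k n e.1.1 e.1.2 e.2.
have [t0 t0P] := fin_all_exists (card_edge_solutions R).
(* There are finitely many subfamilies, so one threshold serves them all. *)
exists (\max_B t0 B)%N => t tt0 ot.
have HP h : h \in ST R k n <-> exists2 e, e \in ordered_edges & h = H e.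
  split=> [/imfsetP[e /= eD ->]|[e]].
    by exists e => //; rewrite inE.
  by rewrite inE => eD ->; apply/imfsetP; exists e.
have H_proper e : e \in ordered_edges -> H e <> [set: 'rV[R]_n]%classic.
  (* The points with all coordinates 0 and all coordinates 1 have coordinate sums 0 and 2, which
     cannot both equal c. *)
  move=> _ HT; have : H e (const_mx 0) by rewrite HT.
  have : H e (const_mx 1) by rewrite HT.
  rewrite /H /ST_hyp /= !mxE addr0 => <- /eqP.
  by rewrite eq_sym -mulr2n pnatr_eq0.
rewrite (whitney HP H_proper) big_mkcondr /=.
pose sols (x : {ffun 'I_n -> 'Z_t}) : {set edge} :=
  [set e in ordered_edges | x e.1.1 + x e.1.2 == e.2%:R].
(* Write t to the dimension as a number of points of (Z/t)^n and exchange the sums: a point x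
   receives the signed sum over the subsets of [sols x], which is 1 if x avoids every hyperplane and
   0 otherwise. *)
transitivity (\sum_(B : {set edge} | B \subset ordered_edges)
   \sum_(x : {ffun 'I_n -> 'Z_t} | B \subset sols x) (-1) ^+ #|B| : int).
  apply: eq_bigr => B BD.
  have := t0P B t (leq_trans (leq_bigmax B) tt0) ot.
  rewrite -/H => cardB.
  rewrite (eq_bigl (mem [set x : {ffun 'I_n -> 'Z_t} |
     [forall e in B, x e.1.1 + x e.1.2 == e.2%:R]])).
    rewrite sumr_const cardB; case: ifP => _; last by rewrite mulr0n.
    by rewrite -mulr_natr natrX natz.
  move=> x; rewrite !inE.
  apply/idP/forall_inP => [/fintype.subsetP xB e eB|xB].
    by have := xB e eB; rewrite inE => /andP[].
  by apply/fintype.subsetP => e eB; rewrite inE (fintype.subsetP BD) ?xB.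
rewrite (exchange_big_dep predT) //=.
under eq_bigr => x _.
  rewrite (eq_bigl (fun B : {set edge} => B \subset sols x)); last first.
    move=> B; rewrite andb_idl // => Bx; apply: fintype.subset_trans Bx _.
    by apply/fintype.subsetP => e; rewrite inE => /andP[].
  rewrite sum_sign_subset; over.
rewrite -natr_sum natz; congr Posz; rewrite -sum1dep_card [RHS]big_mkcond /=.
apply: eq_bigr => x _; rewrite -[RHS]/(nat_of_bool _); congr nat_of_bool.
apply/eqP/forall_inP => [x0 e eD|xa].
  apply/negP => xe; have : e \in finset.set0 by rewrite -x0 inE eD.
  by rewrite inE.
apply/setP => e; rewrite !inE; apply/negP => /andP[eD xe].
by have := xa e; rewrite inE eD xe => /(_ isT).
Qed.

End FiniteFieldMethod.

Lemma avoidingE (k n t : nat) : avoiding k n t = proper_maps k n t.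
Proof.
apply/setP => x; apply/idP/proper_mapsP => [|xP].
  rewrite inE => /forall_inP xa i j ij; apply/imsetP => -[c _ xc].
  wlog lt_ij : i j ij xc / (i < j)%N.
    move=> W; case: (ltngtP i j) => [ij'|ji|/val_inj ijE].
    - exact: (W i j).
    - by apply: (W j i) => //; rewrite 1?eq_sym // addrC.
    - by rewrite ijE eqxx in ij.
  by have := xa (i, j, c); rewrite inE lt_ij /= xc eqxx => /(_ isT).
rewrite inE; apply/forall_inP => -[[i j] c]; rewrite inE /= => lt_ij.
apply: contraNneq (xP i j _) => [->|]; first exact: imset_f.
by apply: contraTneq lt_ij => ->; rewrite ltnn.
Qed.

Theorem theorem4p1 (R : realType) (n k : nat) (hn : (1 <= n)%N)
    (hk : ~~ odd k) :
  exists t0 : nat, forall t : nat, (t0 <= t)%N -> odd t ->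
    ((char_poly_arr (ST R k n)).[t%:Z])%R =
    (onto_sum (I0 k t) n
     + \sum_(0 <= p < k./2.+1) n * onto_sum (I1 k (p%:R : 'Z_t)%R) n.-1
     + \sum_(0 <= j < k./2) n * onto_sum (I1 k (low t j)) n.-1
     + \sum_(0 <= p1 < k./2.+1) \sum_(0 <= p2 < k./2)
         n * n.-1 * onto_sum (I2 k t p1 p2) n.-2)%N%:Z%R.
Proof.
have [t0 t0P] := char_poly_ST k n R.
(* [4 * k + 10] is an ample bound making C1 and C2 disjoint, with no edge between them. *)
exists (maxn t0 (4 * k + 10)) => t; rewrite geq_max => /andP[t0t kt] ot.
by rewrite t0P // avoidingE card_proper_maps.
Qed.
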